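(* Let $Q$ be a profinite quandle. (i) Suppose $Q$ has a fundamental system of entourages $\mathcal{O}$ consisting of open fully invariant congruences. If $\alpha\in\mathcal{O}$, then the natural projection map $\Omega_\alpha:\mathrm{End}(Q)\to\mathrm{End}(Q/\alpha)$ is continuous, and $$\mathrm{End}(Q)\cong\varprojlim_{\alpha\in\mathcal{O}}\Omega_\alpha(\mathrm{End}(Q)).$$ (ii) The analogous results hold for $\mathrm{Aut}(Q)$ and $\mathrm{Inn}(Q)$ if there exists a fundamental system of open characteristic congruences for $Q$: if $\mathcal{O}$ is a fundamental system of entourages consisting of open characteristic congruences, then for $\alpha\in\mathcal{O}$ the natural projections $\Omega_\alpha:\mathrm{Aut}(Q)\to\mathrm{Aut}(Q/\alpha)$ and $\Omega_\alpha:\mathrm{Inn}(Q)\to\mathrm{Inn}(Q/\alpha)$ are continuous, and $\mathrm{Aut}(Q)\cong\varprojlim_{\alpha\in\mathcal{O}}\Omega_\alpha(\mathrm{Aut}(Q))$ and $\mathrm{Inn}(Q)\cong\varprojlim_{\alpha\in\mathcal{O}}\Omega_\alpha(\mathrm{Inn}(Q))$. Furthermore, $$\mathrm{Inn}(Q)\cong\varprojlim_{\alpha\in\mathcal{O}_C}\mathrm{Inn}(Q/\alpha),$$ where $\mathcal{O}_C$ is the collection of all open characteristic congruences for $Q$.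
   Context: A quandle is a non-empty set $Q$ with a binary operation $*$ such that $x*x=x$; for all $x,y$ there is a unique $z$ with $x=z*y$ (write $z=x*^{-1}y$); and $(x*y)*z=(x*z)*(y*z)$. A profinite quandle is a projective limit of a projective system (over a directed set) of finite discrete quandles $Q_i$ with homomorphisms $\varphi_{ij}:Q_j\to Q_i$, i.e. $\{(q_i)\in\prod_i Q_i:\varphi_{ij}(q_j)=q_i \text{ for } i\le j\}$ with the subspace topology of the product topology; it is a compact Hausdorff topological quandle ($*$ is continuous and each right multiplication $R_q:p\mapsto p*q$ is a homeomorphism). $\mathrm{End}(Q)$ is the monoid of continuous quandle endomorphisms, $\mathrm{Aut}(Q)$ the group of continuous quandle automorphisms, and $\mathrm{Inn}(Q)$ the inner automorphism group, i.e. the subgroup of $\mathrm{Aut}(Q)$ generated by the right multiplications $R_q$, $q\in Q$; all carry the compact-open topology inherited from the space $C(Q,Q)$ of continuous maps. A congruence on $Q$ is an equivalence relation compatible with $*$ and $*^{-1}$; it is open if it is open in $Q\times Q$ (then $Q/\alpha$ is a finite discrete quandle). A congruence $\alpha$ is fully invariant (respectively, characteristic) if $(x,y)\in\alpha$ implies $(f(x),f(y))\in\alpha$ for all $f\in\mathrm{End}(Q)$ (respectively, $f\in\mathrm{Aut}(Q)$). The unique uniformity on the compact Hausdorff space $Q$ has as entourages all neighborhoods of the diagonal in $Q\times Q$; a fundamental system of entourages is a family of entourages such that every entourage contains a member of the family. The natural projection is $\Omega_\alpha(\phi)([p]_\alpha)=[\phi(p)]_\alpha$. The families $\mathcal{O}$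 and $\mathcal{O}_C$ are directed by reverse inclusion, and the finite discrete monoids (groups) $\Omega_\alpha(\cdot)$ form a projective system with maps $\Omega_{\alpha\gamma}(\Omega_\gamma(\phi))=\Omega_\alpha(\phi)$ for $\gamma\subset\alpha$; the groups $\mathrm{Inn}(Q/\alpha)$ form a projective system with the maps induced by the quotient maps $Q/\gamma\to Q/\alpha$. The symbol $\cong$ denotes isomorphism of topological monoids (groups).
   Formalization: Inn(Q) is taken to be the closure in Aut(Q) of the subgroup generated by the right multiplications; for the abstract subgroup the isomorphisms for Inn(Q) can fail (e.g. {a} together with the 2-adic integers, x*a = x+1). *)

(* Defs.v *)
From HB Require Import structures.
From mathcomp Require Import all_boot all_algebra generic_quotient.
From mathcomp Require Import all_classical topology.

Set Implicit Arguments.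
Unset Strict Implicit.
Unset Printing Implicit Defensive.

Local Open Scope classical_set_scope.
Local Open Scope quotient_scope.

Reserved Notation "x *q y" (at level 40, left associativity).
Reserved Notation "x /q y" (at level 40, left associativity).

HB.mixin Record isQuandle T := {
  qmul : T -> T -> T;
  quandle_inhabited : inhabited T;
  qmulxx : forall x, qmul x x = x;
  qmul_ex_uniq : forall x y, exists! z, x = qmul z y;
  qmul_dist : forall x y z,
    qmul (qmul x y) z = qmul (qmul x z) (qmul y z)
}.

#[short(type="quandleType")]
HB.structure Definition Quandle := { T of isQuandle T }.

Declare Scope quandle_scope.
Delimit Scope quandle_scope with quandle.
Local Open Scope quandle_scope.

Notation "x *q y" := (qmul x y) : quandle_scope.

(* x /q y is the element written x *^{-1} y in the literature *)
Definition qdiv (Q : quandleType) (x y : Q) : Q := sval (cid (qmul_ex_uniq x y)).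

Notation "x /q y" := (qdiv x y) : quandle_scope.

Lemma qdivK (Q : quandleType) (x y : Q) : (x /q y) *q y = x.
Proof. by rewrite /qdiv; case: cid => z /= [-> _]. Qed.

Lemma qmulK (Q : quandleType) (x y : Q) : (x *q y) /q y = x.
Proof. by rewrite /qdiv; case: cid => z /= [_ zP]; exact: zP. Qed.

Definition quandle_hom (X Y : quandleType) (f : X -> Y) :=
  {morph f : x y / x *q y}.

(* A quandle and a topology on the same set, with no compatibility axiom; the *)
(* compatibility is part of the predicate [profinite_quandle] below.          *)
#[short(type="preTopologicalQuandleType")]
HB.structure Definition PreTopologicalQuandle := { T of Quandle T & Topological T }.

Definition directed (I : Type) (le : I -> I -> Prop) :=
  [/\ inhabited I, (forall i, le i i),
      (forall i j k, le i j -> le j k -> le i k) &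
      (forall i j, exists2 k, le i k & le j k)].

(* The limit of the subsets A i of T i along t i j : T j -> T i, for i <= j   *)
Definition proj_lim (I : Type) (le : I -> I -> Prop) (T : I -> Type)
    (t : forall i j, le i j -> T j -> T i) (A : forall i, set (T i)) :
    set (prod_topology T) :=
  [set x | (forall i, A i (x i)) /\
           (forall i j (ij : le i j), t i j ij (x j) = x i)].

Definition homeo_on (X Y : topologicalType) (A : set X) (B : set Y) (f : X -> Y) :=
  [/\ set_bij A B f, {within A, continuous f} &
      exists2 g : Y -> X, {in A, cancel f g} & {within B, continuous g}].

Definition continuous_map (X Y : topologicalType) (A : set X) (B : set Y)
    (f : X -> Y) :=
  set_fun A B f /\ {within A, continuous f}.

Definition finite_discrete (X : topologicalType) :=
  finite_set [set: X] /\ forall A : set X, open A.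

Definition profinite_quandle (Q : preTopologicalQuandleType) : Prop :=
  exists (I : Type) (le : I -> I -> Prop) (S : I -> preTopologicalQuandleType)
         (phi : forall i j, le i j -> S j -> S i),
  [/\ directed le, (forall i, finite_discrete (S i)),
      (forall i j (ij : le i j), quandle_hom (phi i j ij)),
      (forall i (ii : le i i) x, phi i i ii x = x) /\
      (forall i j k (ij : le i j) (jk : le j k) (ik : le i k) x,
         phi i j ij (phi j k jk x) = phi i k ik x) &
      exists f : Q -> prod_topology S,
        homeo_on [set: Q] (proj_lim phi (fun=> setT)) f /\
        forall x y i, f (x *q y) i = f x i *q f y i].

#[short(type="preTopologicalMonoidType")]
HB.structure Definition PreTopologicalMonoid := { M of Monoid M & Topological M }.

Section CompactOpenMonoid.
Variable X : topologicalType.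
Let M := {compact-open, X -> X}.
Let comp (f g : M) : M := f \o g.

Let compA : associative comp. Proof. by []. Qed.
Let comp1 : left_id (idfun : M) comp. Proof. by []. Qed.
Let comp_1 : right_id (idfun : M) comp. Proof. by []. Qed.

HB.instance Definition _ := isMonoid.Build {compact-open, X -> X} compA comp1 comp_1.

End CompactOpenMonoid.

Section ProductMonoid.
Variables (I : Type) (M : I -> preTopologicalMonoidType).
Let P := prod_topology M.
Let one : P := fun=> 1%g.
Let mul (x y : P) : P := fun i => (x i * y i)%g.

Let mulA : associative mul.
Proof. by move=> x y z; apply: functional_extensionality_dep => i; exact: mulgA. Qed.
Let mul1 : left_id one mul.
Proof. by move=> x; apply: functional_extensionality_dep => i; exact: mul1g. Qed.
Let mul_1 : right_id one mul.
Proof. by move=> x; apply: functional_extensionality_dep => i; exact: mulg1. Qed.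

HB.instance Definition _ := isMonoid.Build (prod_topology M) mulA mul1 mul_1.

End ProductMonoid.

(* Isomorphism of topological monoids between submonoids A of M and B of N.   *)
(* When A and B are groups this is isomorphism of topological groups.         *)
Definition top_monoid_iso (M N : preTopologicalMonoidType) (A : set M) (B : set N) :=
  exists f : M -> N,
    [/\ homeo_on A B f, f 1%g = 1%g & {in A &, {morph f : x y / (x * y)%g}}].

Section EndAutInn.
Variable Q : preTopologicalQuandleType.

Definition qEnd : set {compact-open, Q -> Q} :=
  [set f | continuous (f : Q -> Q) /\ quandle_hom (f : Q -> Q)].

Definition qAut : set {compact-open, Q -> Q} :=
  [set f | qEnd f /\ exists2 g, qEnd g & cancel f g /\ cancel g f].

Definition aut_subgroup (G : set {compact-open, Q -> Q}) :=
  [/\ G `<=` qAut, G 1%g, (forall f g, G f -> G g -> G (f * g)%g) &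
      (forall f g, G f -> cancel f g -> cancel g f -> G g)].

Definition rmul (q : Q) : {compact-open, Q -> Q} := fun p => p *q q.

Definition qInn_abs : set {compact-open, Q -> Q} :=
  smallest aut_subgroup (range rmul).

(* As is usual for profinite structures, "generated" is meant topologically:  *)
(* Inn(Q) is the closure of [qInn_abs] in Aut(Q).  The abstract subgroup need *)
(* not be closed: if Q is the disjoint union of {a} and the 2-adic integers,  *)
(* with x * a = x + 1 for x <> a and u * v = u in all other cases, then it is *)
(* infinite cyclic, whereas every Inn(Q/alpha) is finite and their limit is   *)
(* uncountable.  The closure changes nothing for finite discrete quandles,    *)
(* see [finite_qInn].                                                         *)
Definition qInn : set {compact-open, Q -> Q} := qAut `&` closure qInn_abs.

Lemma qAut_subgroup : aut_subgroup qAut.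
Proof.
have id1 : qEnd (1%g : {compact-open, Q -> Q}) by split=> [x|x y].
split; [by move=> f []|by split=> //; exists 1%g|..].
- move=> f g [[fc fm] [f' [f'c f'm] [fK fK']]] [[gc gm] [g' [g'c g'm] [gK gK']]].
  split; first split=> [x|x y].
  + by apply: (@continuous_comp _ _ _ (g : Q -> Q) (f : Q -> Q)); [exact: gc|exact: fc].
  + exact: etrans (congr1 f (gm x y)) (fm _ _).
  exists (g' * f')%g; first split=> [x|x y].
  + by apply: (@continuous_comp _ _ _ (f' : Q -> Q) (g' : Q -> Q));
      [exact: f'c|exact: g'c].
  + exact: etrans (congr1 g' (f'm x y)) (g'm _ _).
  split=> x; first exact: etrans (congr1 g' (fK (g x))) (gK x).
  exact: etrans (congr1 f (gK' (f' x))) (fK' x).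
- move=> f g [fE [f' f'E [fK fK']]] fg gf.
  suff -> : g = f' by split=> //; exists f.
  by apply: functional_extensionality_dep => x; rewrite -[x in LHS]fK' fg.
Qed.

End EndAutInn.
Arguments qEnd : clear implicits.
Arguments qAut : clear implicits.
Arguments qInn : clear implicits.
Arguments qInn_abs : clear implicits.

Lemma finite_qInn (X : preTopologicalQuandleType) :
  finite_discrete X -> qInn X = qInn_abs X.
Proof.
move=> [Xfin Xdisc].
have Xcont (f : X -> X) : continuous f by apply/continuousP => A _; exact: Xdisc.
have rAut : range (@rmul X) `<=` qAut X.
  have dK (q : X) : cancel (rmul q) (fun x => x /q q) by move=> x; exact: qmulK.
  have dK' (q : X) : cancel (fun x => x /q q) (rmul q) by move=> x; exact: qdivK.
  have rhom q : quandle_hom (rmul q : X -> X) by move=> x y; exact: qmul_dist.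
  move=> _ [q _ <-]; split; first by split.
  exists (fun x => x /q q); last by split.
  split; first exact: Xcont.
  move=> x y; apply: (can_inj (dK q)).
  by rewrite (rhom q) !dK'.
apply/seteqP; split=> f; last first.
  move=> If; split; last exact: subset_closure.
  by apply: If; split=> //; exact: qAut_subgroup.
case=> _ /(_ [set f]) []; last by move=> g [Ig <-].
have -> : [set f] = \bigcap_(x in [set: X]) [set g : {compact-open, X -> X} | g x = f x].
  apply/seteqP; split=> [g -> //|g fg] /=.
  by apply: functional_extensionality_dep => x; exact: fg.
have [D ->] := (@finite_fsetP _ _).1 Xfin.
apply: filter_bigI => x _; apply: open_nbhs_nbhs; split=> //.
have -> : [set g : {compact-open, X -> X} | g x = f x] =
          [set g | g @` [set x] `<=` [set f x]].
  apply/seteqP; split=> g /=; first by move=> gx _ [_ -> <-].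
  by apply; exists x.
by apply: compact_open_open; [exact: compact_set1|exact: Xdisc].
Qed.

Record congruence (Q : quandleType) := Congruence {
  congr_rel :> Q -> Q -> Prop;
  congr_refl : forall x, congr_rel x x;
  congr_sym : forall x y, congr_rel x y -> congr_rel y x;
  congr_trans : forall x y z, congr_rel x y -> congr_rel y z -> congr_rel x z;
  congr_mul : forall x x' y y',
    congr_rel x x' -> congr_rel y y' -> congr_rel (x *q y) (x' *q y');
  congr_div : forall x x' y y',
    congr_rel x x' -> congr_rel y y' -> congr_rel (x /q y) (x' /q y')
}.

Definition subcongruence (Q : quandleType) (a b : congruence Q) :=
  forall x y, a x y -> b x y.

Definition congr_graph (Q : quandleType) (a : congruence Q) : set (Q * Q) :=
  [set p | a p.1 p.2].

Section Quotient.
Variables (Q : preTopologicalQuandleType) (a : congruence Q).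

Definition congr_bool (x y : Q) : bool := `[< a x y >].

Lemma congr_bool_equiv : equiv_class_of congr_bool.
Proof.
split=> [x|x y|y x z].
- exact/asboolP/congr_refl.
- by apply/asboolP/asboolP => /congr_sym.
- by move=> /asboolP xy /asboolP yz; apply/asboolP; exact: congr_trans xy yz.
Qed.

Canonical congr_equiv := EquivRelPack congr_bool_equiv.

Definition quandle_quot : Type := quotient_topology {eq_quot congr_equiv}.

HB.instance Definition _ := Topological.on quandle_quot.
HB.instance Definition _ := Quotient.copy quandle_quot {eq_quot congr_equiv}.

Definition qpi (x : Q) : quandle_quot := \pi_quandle_quot x.

Lemma qpiP x y : qpi x = qpi y <-> a x y.
Proof.
rewrite /qpi; split=> [/(@eqquotP _ congr_equiv)/asboolP//|xy].
by apply/(@eqquotP _ congr_equiv)/asboolP.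
Qed.

Lemma qpi_repr (c : quandle_quot) : qpi (repr c) = c.
Proof. exact: reprK. Qed.

Lemma repr_qpi x : a (repr (qpi x)) x.
Proof. by apply/qpiP; rewrite qpi_repr. Qed.

Let mul (c d : quandle_quot) : quandle_quot := qpi (repr c *q repr d).

Let mulE x y : mul (qpi x) (qpi y) = qpi (x *q y).
Proof. by apply/qpiP; apply: congr_mul; exact: repr_qpi. Qed.

Let quot_inhabited : inhabited quandle_quot.
Proof. by case: (@quandle_inhabited Q) => x; exists; exact: qpi x. Qed.

Let mulxx c : mul c c = c.
Proof. by rewrite -[c]qpi_repr mulE qmulxx. Qed.

Let mul_ex_uniq c d : exists! z, c = mul z d.
Proof.
rewrite -[c]qpi_repr -[d]qpi_repr; exists (qpi (repr c /q repr d)); split.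
  by rewrite mulE qdivK.
move=> z; rewrite -[z]qpi_repr mulE => /qpiP cz; apply/qpiP.
rewrite -[X in a _ X](qmulK _ (repr d)).
by apply: congr_div => //; exact: congr_refl.
Qed.

Let mul_dist c d e : mul (mul c d) e = mul (mul c e) (mul d e).
Proof.
by rewrite -[c]qpi_repr -[d]qpi_repr -[e]qpi_repr !mulE qmul_dist.
Qed.

HB.instance Definition _ :=
  isQuandle.Build quandle_quot quot_inhabited mulxx mul_ex_uniq mul_dist.

Lemma qpi_hom : quandle_hom qpi.
Proof. by move=> x y; exact/esym/mulE. Qed.

(* The representative plays no role when f preserves a, see [OmegaE].         *)
Definition Omega (f : {compact-open, Q -> Q}) :
    {compact-open, quandle_quot -> quandle_quot} :=
  fun c => qpi (f (repr c)).

Lemma OmegaE (f : {compact-open, Q -> Q}) :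
  (forall x y, a x y -> a (f x) (f y)) -> forall p, Omega f (qpi p) = qpi (f p).
Proof. by move=> af p; apply/qpiP; apply: af; exact: repr_qpi. Qed.

End Quotient.
Arguments Omega {Q} a f.

Section Transition.
Variables (Q : preTopologicalQuandleType) (c a : congruence Q).
Hypothesis ca : subcongruence c a.

Definition quot_map (u : quandle_quot c) : quandle_quot a := qpi a (repr u).

Lemma quot_mapE x : quot_map (qpi c x) = qpi a x.
Proof. by apply/qpiP; apply: ca; exact: repr_qpi. Qed.

(* The map induced on Q/a by a self-map of Q/c, through Q/c -> Q/a            *)
Definition quot_trans (f : {compact-open, quandle_quot c -> quandle_quot c}) :
    {compact-open, quandle_quot a -> quandle_quot a} :=
  fun u => quot_map (f (qpi c (repr u))).

Lemma quot_transE (f : {compact-open, quandle_quot c -> quandle_quot c}) :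
  (forall u v, quot_map u = quot_map v -> quot_map (f u) = quot_map (f v)) ->
  forall u, quot_trans f (quot_map u) = quot_map (f u).
Proof. by move=> cf u; apply: cf; rewrite quot_mapE qpi_repr. Qed.

Lemma quot_trans_Omega (f : {compact-open, Q -> Q}) :
  (forall x y, c x y -> c (f x) (f y)) -> (forall x y, a x y -> a (f x) (f y)) ->
  quot_trans (Omega c f) = Omega a f.
Proof.
move=> cf af; apply: functional_extensionality_dep => u.
by rewrite /quot_trans OmegaE// quot_mapE.
Qed.

End Transition.

Section Systems.
Variable Q : preTopologicalQuandleType.

Definition open_congruence (a : congruence Q) := open (congr_graph a).

Definition fully_invariant (a : congruence Q) :=
  forall f, qEnd Q f -> forall x y, a x y -> a (f x) (f y).

Definition characteristic (a : congruence Q) :=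
  forall f, qAut Q f -> forall x y, a x y -> a (f x) (f y).

(* The entourages of the compact Hausdorff space Q are the neighbourhoods of  *)
(* the diagonal.                                                              *)
Definition fundamental_system (O : set (congruence Q)) :=
  (forall a, O a -> set_nbhs diagonal (congr_graph a)) /\
  (forall E : set (Q * Q), set_nbhs diagonal E ->
     exists2 a, O a & congr_graph a `<=` E).

Definition open_characteristic : set (congruence Q) :=
  [set a | open_congruence a /\ characteristic a].

Definition quot_lim (O : set (congruence Q))
    (A : forall a : congruence Q, set {compact-open, quandle_quot a -> quandle_quot a}) :
    set (prod_topology (fun a : O =>
           {compact-open, quandle_quot (val a) -> quandle_quot (val a)})) :=
  @proj_lim O (fun a c => subcongruence (val c) (val a)) _
    (fun a c _ => @quot_trans Q (val c) (val a)) (fun a => A (val a)).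

End Systems.
Arguments quot_lim {Q} O A.

(* Main.v *)
From HB Require Import structures.
Require Import Defs.
From mathcomp Require Import all_boot finmap all_classical topology.

Set Implicit Arguments.
Unset Strict Implicit.
Unset Printing Implicit Defensive.

(** As a closed subspace of a product of finite discrete spaces, [Q] is compact
    and Hausdorff.  So the classes modulo the members of a fundamental system
    [O] of open congruences separate the points and form a basis of the
    topology, and each quotient [quandle_quot a] is finite and discrete.  The whole theorem rests on the following description of the
    compact-open topology: the sets
      [agree_mod a f = {g | for all x, f x and g x are congruent modulo a}]
    for [a] in [O] form a basis of neighbourhoods of a continuous map [f]
    ([agree_mod_nbhs] and [agree_mod_cvg]).  This is the topology of uniform
    convergence, the entourages being congruences.

    For maps that preserve [a], agreeing modulo [a] means having the same image
    under [Omega a].  Hence [Omega a] is locally constant, so continuous, and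
    the map [f |-> (Omega a f)_a] on a set [A] of such maps is injective,
    continuous, and has a continuous inverse on its image, because prescribing
    one coordinate of the image prescribes the map up to [a].

    What depends on [A] is surjectivity onto the limit: a family [phi a] in [A]
    with [phi c] and [phi a] agreeing modulo [a] whenever [c] is contained in
    [a] must come from a single [f] in [A]; this is the predicate [glues].  At
    each point the classes of [phi a x] are closed, nonempty and directed, so
    compactness yields a common point [f x]; everything about [f] is then
    checked modulo every [a], where [f] is [phi a].  This gives End
    ([glue_End]); for Aut the inverses are glued as well ([glue_Aut]); Inn is
    closed in Aut, and [f] is approximated by the [phi a] ([glue_Inn]).  The
    isomorphism itself is proved once for all three in [lim_iso].

    For the last isomorphism, [Omega a] maps the right multiplication by [q] to
    that by the class of [q], so it maps the group generated by the ones onto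
    the group generated by the others; as the quotient is discrete, passing to
    the closure adds no image ([Omega_qInn]). *)

Local Open Scope classical_set_scope.
Local Open Scope quandle_scope.

(** * Product topologies and profinite quandles *)

Lemma prod_topology_cvg (I : Type) (T : I -> topologicalType)
    (F : set_system (prod_topology T)) (p : prod_topology T) : Filter F ->
  (forall i (U : set (T i)), nbhs (p i) U -> F [set x | U (x i)]) -> F --> p.
Proof.
move=> FF Fp; apply/cvg_sup => i U [_ [[V oV <-] Vp] VU].
by apply: filterS VU _; apply: (Fp i); exact: open_nbhs_nbhs.
Qed.

Lemma prod_coord_nbhs (I : Type) (T : I -> topologicalType)
    (p : prod_topology T) i (U : set (T i)) :
  nbhs (p i) U -> nbhs p [set x : prod_topology T | U (x i)].
Proof. exact: (@proj_continuous {classic I} T i p). Qed.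

Lemma finite_discrete_hausdorff (X : topologicalType) :
  finite_discrete X -> hausdorff_space X.
Proof.
move=> [_ oX] p q /(_ [set p] [set q]) [].
- by apply: open_nbhs_nbhs.
- by apply: open_nbhs_nbhs.
- by move=> _ [/= -> ->].
Qed.

(** Each equation [t i j ij (x j) = x i] involves two coordinates only, and these
    are locally constant. *)
Lemma proj_lim_closed (I : Type) (le : I -> I -> Prop) (T : I -> topologicalType)
    (t : forall i j, le i j -> T j -> T i) :
  (forall i (A : set (T i)), open A) -> closed (proj_lim t (fun=> setT)).
Proof.
move=> oT p clp; split=> // i j ij.
have nb k : nbhs p [set x : prod_topology T | x k = p k].
  by apply: (@prod_coord_nbhs I T p k [set p k]); exact: open_nbhs_nbhs.
have [x [[_ /(_ i j ij) xij] [/= <- <-]]] := clp _ (filterI (nb i) (nb j)).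
exact: xij.
Qed.

Lemma profinite_compact_hausdorff (Q : preTopologicalQuandleType) :
  profinite_quandle Q -> compact [set: Q] /\ hausdorff_space Q.
Proof.
move=> [I [le [S [phi [_ Sfin _ _ [f [[[fL finj fsurj] fc [g fg gc]] _]]]]]]].
have Lcomp : compact (proj_lim phi (fun=> setT)).
  apply: (@subclosed_compact _ _ [set: prod_topology S]) => //.
    by apply: proj_lim_closed => i; case: (Sfin i).
  have /(@tychonoff {classic I} S) : forall i, compact [set: S i].
    by move=> i; apply: finite_compact; case: (Sfin i).
  by congr (compact _); apply/seteqP; split.
split.
  have -> : [set: Q] = g @` proj_lim phi (fun=> setT).
    apply/seteqP; split=> // x _; exists (f x); first exact: fL.
    by apply: fg; rewrite inE.
  exact: continuous_compact.
move=> x y xy; apply: finj; rewrite ?inE //.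
have Phaus : hausdorff_space (prod_topology S) :=
  @hausdorff_product {classic I} S
    (fun i => finite_discrete_hausdorff (Sfin i)).
apply: (Phaus (f x) (f y)) => U V.
have fcont : continuous f by apply/continuous_subspace_setT.
move=> /(fcont x) Ux /(fcont y) Vy.
by have [z [Uz Vz]] := xy _ _ Ux Vy; exists (f z).
Qed.

(** * Finite discrete quotients *)

(** A map on a finite set is determined by finitely many values, each of which
    is an open condition because points are compact and open. *)
Lemma finite_discrete_compact_open (X : topologicalType) :
  finite_discrete X -> forall f : {compact-open, X -> X}, open [set f].
Proof.
move=> [Xfin Xdisc] f.
have -> : [set f] = \bigcap_(x in [set: X])
    [set g : {compact-open, X -> X} | g @` [set x] `<=` [set f x]].
  apply/seteqP; split=> [g -> x _ _ [_ -> <-]//|g fg] /=.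
  by apply: funext => x; apply: (fg x I); exists x.
have [D ->] := (@finite_fsetP _ _).1 Xfin.
rewrite openE => g gD; apply: filter_bigI => x xD.
apply: open_nbhs_nbhs; split; last exact: gD.
by apply: compact_open_open; [exact: compact_set1|exact: Xdisc].
Qed.

(** The base point [x0] is there to turn [X] into a pointed space, the setting of
    the covering characterization of compactness. *)
Lemma compact_finite_subcover (X : topologicalType) (x0 : X) (U : X -> set X) :
  compact [set: X] -> (forall x, open (U x)) -> (forall x, U x x) ->
  exists2 D : set X, finite_set D & forall x, exists2 d, D d & U d x.
Proof.
pose Xp : ptopologicalType :=
  HB.pack (X : Type) (Topological.on X) (isPointed.Build X x0).
move=> Xcomp oU Ux; have : @cover_compact Xp setT by rewrite -compact_cover.
case/(_ X setT U) => [x _|x _|D _ Dcov]; [exact: oU|by exists x|].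
exists [set` D] => [|x]; first exact: finite_fset.
by have [//|d Dd dx] := Dcov x; exists d.
Qed.

Section OpenCongruence.
Variables (Q : preTopologicalQuandleType) (a : congruence Q).
Hypotheses (Qcomp : compact [set: Q]) (aopen : open_congruence a).

Lemma open_class x : open [set y | a x y].
Proof.
rewrite openE => y xy.
have [[U V] [Ux Vy] UV] : nbhs (x, y) (congr_graph a).
  exact: open_nbhs_nbhs.
apply: filterS Vy => z Vz; apply: (UV (x, z)); split=> //.
exact: nbhs_singleton.
Qed.

Lemma quot_discrete (A : set (quandle_quot a)) : open A.
Proof.
have -> : A = \bigcup_(c in A) [set c].
  by apply/seteqP; split=> [c Ac|c [d Ad ->]//]; exists c.
apply: bigcup_open => c _.
suff : open (qpi a @^-1` [set c]) by [].
rewrite (_ : _ @^-1` _ = [set y | a (repr c) y]); first exact: open_class.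
apply/seteqP; split=> y /=; first by move=> <-; exact: repr_qpi.
by move=> /qpiP <-; rewrite qpi_repr.
Qed.

Lemma quot_finite_discrete : finite_discrete (quandle_quot a).
Proof.
split; last exact: quot_discrete.
have [x0] := @quandle_inhabited Q.
have [x|x|D Dfin Dcov] :=
  compact_finite_subcover x0 Qcomp (U := fun x => [set y | a x y]).
- exact: open_class.
- exact: congr_refl.
have : finite_set (qpi a @` D) by exact: finite_image.
apply: sub_finite_set => c _; have [x xD xc] := Dcov (repr c).
by exists x => //; rewrite -[c]qpi_repr; exact/qpiP.
Qed.

End OpenCongruence.

(** * Uniform description of the compact-open topology *)

Definition agree_mod (Q : preTopologicalQuandleType) (a : congruence Q)
    (f : {compact-open, Q -> Q}) : set {compact-open, Q -> Q} :=
  [set g | forall x, a (f x) (g x)].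

Definition preserves (Q : quandleType) (f : Q -> Q) (a : congruence Q) :=
  forall x y, a x y -> a (f x) (f y).

(** [f] is constant modulo [a] on each set [K c] below; these sets are compact and
    finite in number, and agreeing with [f] modulo [a] on [K c] is the subbasic
    condition of mapping [K c] into an open class. *)
Lemma agree_mod_nbhs (Q : preTopologicalQuandleType) (a : congruence Q)
    (f : {compact-open, Q -> Q}) :
  compact [set: Q] -> open_congruence a -> continuous (f : Q -> Q) ->
  nbhs f (agree_mod a f).
Proof.
move=> Qcomp aopen fc.
pose K (c : quandle_quot a) := f @^-1` [set y | a (repr c) y].
have Kcl c : closed (K c).
  apply: (@closed_comp _ _ (f : Q -> Q)) => [x _|]; first exact: fc.
  (* A class is closed since its complement is the union of the other classes. *)
  have -> : [set y | a (repr c) y] =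
      ~` \bigcup_(z in ~` [set y | a (repr c) y]) [set y | a z y].
    apply/seteqP; split=> y /=.
    - by move=> cy [z cz /congr_sym zy]; apply: cz; exact: congr_trans cy zy.
    - move=> ny; apply: contrapT => cy; apply: ny; exists y => //.
      exact: congr_refl.
  by apply/open_closedC/bigcup_open => z _; exact: open_class.
have -> : agree_mod a f = \bigcap_(c in [set: quandle_quot a])
    [set g | g @` K c `<=` [set y | a (repr c) y]].
  apply/seteqP; split=> [g fg c _ _ [x Kx <-]|g fg x]; rewrite /=.
    exact: congr_trans Kx (fg x).
  apply: congr_trans (congr_sym (repr_qpi a (f x))) _.
  by apply: (fg (qpi a (f x))) => //; exists x => //; exact: repr_qpi.
have [D ->] := (@finite_fsetP _ _).1 (quot_finite_discrete Qcomp aopen).1.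
apply: filter_bigI => c _.
apply: open_nbhs_nbhs; split; last by move=> _ [x Kx <-].
apply: compact_open_open; last exact: open_class.
exact: subclosed_compact (Kcl c) Qcomp _.
Qed.

Section FundamentalSystem.
Variables (Q : preTopologicalQuandleType) (O : set (congruence Q)).
Hypotheses (Qcomp : compact [set: Q]) (Qhaus : hausdorff_space Q).
Hypotheses (Ofund : fundamental_system O).
Hypotheses (Oopen : forall a, O a -> open_congruence a).

(** The set [(U x U) `|` (~` K x ~` K)] is a neighbourhood of the diagonal because
    [K] is closed and contained in [U]; any pair in it whose first entry is in
    [K] has its second entry in [U].  For [K] a point, this says that the
    classes form a basis of the topology. *)
Lemma fundamental_compact_sub (K U : set Q) : compact K -> open U -> K `<=` U ->
  exists2 a, O a & forall x y, K x -> a x y -> U y.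
Proof.
move=> Kcomp Uopen KU.
pose E := (U `*` U) `|` (~` K `*` ~` K).
have [|a Oa aE] := Ofund.2 E.
  move=> [x x'] xx'; rewrite -(xx' : x = x').
  have [Kx|nKx] := pselect (K x).
    have Ux : nbhs x U by apply: open_nbhs_nbhs; split=> //; exact: KU.
    by exists (U, U) => // z Uz; left.
  have Kc : nbhs x (~` K).
    apply: open_nbhs_nbhs; split=> //; apply: closed_openC.
    exact: compact_closed.
  by exists (~` K, ~` K) => // z Kz; right.
exists a => // x y Kx /(aE (x, y)) [[_ //]|[/=]].
by move=> nKx; have := nKx Kx.
Qed.

Lemma fundamental_separates x y : (forall a, O a -> a x y) -> x = y.
Proof.
move=> xy; apply: contrapT => nxy.
have [||z ->|a Oa ax] := @fundamental_compact_sub [set x] (~` [set y]).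
- exact: compact_set1.
- apply: closed_openC; apply: compact_closed => //; exact: compact_set1.
- exact: nxy.
- exact: (ax x y erefl (xy a Oa)).
Qed.

Lemma fundamental_continuous (f : Q -> Q) :
  (forall a, O a -> preserves f a) -> continuous f.
Proof.
move=> fO x U; rewrite nbhsE => -[V [Vopen Vfx] VU].
have [|_ ->//|a Oa aV] := @fundamental_compact_sub [set f x] V _ Vopen.
  exact: compact_set1.
have xa : nbhs x [set y | a x y].
  by apply: open_nbhs_nbhs; split; [exact/open_class/Oopen|exact: congr_refl].
apply: filterS xa => y xy; apply: VU; apply: aV (fO a Oa _ _ xy); exact: erefl.
Qed.

(** A subbasic neighbourhood of [f], given by [K] compact and [U] open, contains
    some [agree_mod a f]: apply [fundamental_compact_sub] to the compact set
    [f @` K]. *)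
Lemma agree_mod_cvg (F : set_system {compact-open, Q -> Q})
    (f : {compact-open, Q -> Q}) :
  Filter F -> continuous (f : Q -> Q) -> (forall a, O a -> F (agree_mod a f)) ->
  F --> f.
Proof.
move=> FF fc Ff; apply/compact_open_cvgP => K U Kcomp Uopen fKU.
have [|a Oa aU] := @fundamental_compact_sub (f @` K) U _ Uopen fKU.
  by apply: continuous_compact => //; exact: continuous_subspaceT.
apply: filterS (Ff a Oa) => g fg _ [x Kx <-].
by apply: aU (fg x); exists x.
Qed.

Lemma fundamental_lb a b : O a -> O b ->
  exists c, [/\ O c, subcongruence c a & subcongruence c b].
Proof.
move=> Oa Ob.
have [|c Oc cE] := Ofund.2 (congr_graph a `&` congr_graph b).
  by move=> p pp; apply: filterI; apply: Ofund.1.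
by exists c; split=> // x y /(cE (x, y)) [].
Qed.

Lemma fundamental_ex : exists a, O a.
Proof.
by have [|a Oa _] := Ofund.2 setT; [move=> p _; exact: filterT|exists a].
Qed.

(** * Gluing coherent families of maps *)

(** The classes of the [p a] generate a proper filter, and a class containing a
    cluster point [y] must meet, hence equal, the class of [p a]. *)
Lemma coherent_point (p : congruence Q -> Q) :
  (forall a c, O a -> O c -> subcongruence c a -> a (p a) (p c)) ->
  exists y, forall a, O a -> a (p a) y.
Proof.
move=> pcoh; pose F := filter_from O (fun a => [set y | a (p a) y]).
have FF : ProperFilter F.
  apply: filter_from_proper => [|a _]; last by exists (p a); exact: congr_refl.
  apply: filter_from_filter; first exact: fundamental_ex.
  move=> a b Oa Ob; have [c [Oc ca cb]] := fundamental_lb Oa Ob.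
  exists c => // y cy; split=> /=.
    by apply: congr_trans (pcoh a c Oa Oc ca) _; exact: ca.
  by apply: congr_trans (pcoh b c Ob Oc cb) _; exact: cb.
have [y [_ Fy]] := Qcomp FF filterT.
exists y => a Oa.
have ya : nbhs y [set z | a y z].
  by apply: open_nbhs_nbhs; split; [exact/open_class/Oopen|exact: congr_refl].
have Fa : F [set z | a (p a) z] by exists a.
have [z [/= az yz]] := Fy _ _ Fa ya.
exact: congr_trans az (congr_sym yz).
Qed.

(** The glued map is defined pointwise by [coherent_point]; its continuity and
    the morphism identity are checked modulo one [a] at a time, where it
    coincides with [phi a]. *)
Lemma glue_End (phi : congruence Q -> {compact-open, Q -> Q}) :
  (forall a, O a -> qEnd Q (phi a) /\ preserves (phi a) a) ->
  (forall a c, O a -> O c -> subcongruence c a -> agree_mod a (phi a) (phi c)) ->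
  exists2 f, qEnd Q f & forall a, O a -> agree_mod a f (phi a).
Proof.
move=> phiE coh.
have /choice[f fP] : forall x, exists y, forall a, O a -> a (phi a x) y.
  by move=> x; apply: coherent_point => a c Oa Oc ca; exact: coh.
exists f; last by move=> a Oa x; apply/congr_sym/fP.
split.
  apply: fundamental_continuous => a Oa x y xy.
  apply: congr_trans (congr_sym (fP x a Oa)) _.
  by apply: congr_trans (fP y a Oa); exact: (phiE a Oa).2.
move=> x y; apply: fundamental_separates => a Oa.
apply: congr_trans (congr_sym (fP _ a Oa)) _.
by rewrite (phiE a Oa).1.2; apply: congr_mul; exact: fP.
Qed.

Definition glues (A : set {compact-open, Q -> Q}) :=
  forall phi : congruence Q -> {compact-open, Q -> Q},
  (forall a, O a -> A (phi a)) ->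
  (forall a c, O a -> O c -> subcongruence c a -> agree_mod a (phi a) (phi c)) ->
  exists2 f, A f & forall a, O a -> agree_mod a f (phi a).

(** The inverses [psi a] of the [phi a] are again coherent, and the two glued maps
    are inverse to each other modulo every [a]. *)
Lemma glue_Aut :
  (forall a f, O a -> qAut Q f -> preserves f a) -> glues (qAut Q).
Proof.
move=> Opres phi phiA coh.
have [|f fE fP] := glue_End _ coh.
  by move=> a Oa; split; [exact: (phiA a Oa).1|exact/Opres/phiA].
have /choice[psi psiP] : forall a, exists g, O a ->
    [/\ qAut Q g, cancel (phi a) g & cancel g (phi a)].
  move=> a; have [Oa|nOa] := pselect (O a); last by exists id.
  have [_ [g gE [gK gK']]] := phiA a Oa; exists g => _; split=> //.
  by split=> //; exists (phi a) => //; exact: (phiA a Oa).1.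
have psiO a : O a -> preserves (psi a) a.
  by move=> Oa; apply: Opres => //; have [] := psiP a Oa.
have [| |g gE gP] := @glue_End psi.
- by move=> a Oa; split; [have [[]] := psiP a Oa|exact: psiO].
- move=> a c Oa Oc ca x.
  have [_ aK aK'] := psiP a Oa; have [_ _ cK] := psiP c Oc.
  rewrite -[X in a _ X]aK; apply: psiO => //.
  by rewrite -[X in a X _](cK x); apply/congr_sym/coh.
exists f => //; split=> //; exists g => //; split=> x.
  apply: fundamental_separates => a Oa; have [_ aK _] := psiP a Oa.
  apply: congr_trans (gP a Oa _) _; rewrite -[X in a _ X]aK.
  by apply: psiO => //; exact: fP.
apply: fundamental_separates => a Oa; have [_ _ aK] := psiP a Oa.
apply: congr_trans (fP a Oa _) _; rewrite -[X in a _ X](aK x).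
by apply: Opres => //; [exact: phiA|exact: gP].
Qed.

End FundamentalSystem.

(** * The projections onto the quotients *)

Section Omega.
Variables (Q : preTopologicalQuandleType) (a : congruence Q).
Local Notation M := {compact-open, Q -> Q}.
Local Notation Qa := (quandle_quot a).

Lemma Omega1 : Omega a 1%g = 1%g.
Proof. by apply: funext => c; exact: qpi_repr. Qed.

Lemma OmegaM (f g : M) : preserves f a ->
  Omega a (f * g)%g = (Omega a f * Omega a g)%g.
Proof. by move=> fa; apply: funext => c; apply/esym/OmegaE. Qed.

Lemma Omega_agree_mod (f g : M) : agree_mod a f g -> Omega a f = Omega a g.
Proof. by move=> fg; apply: funext => c; apply/qpiP. Qed.

Lemma agree_mod_Omega (f g : M) : preserves f a -> preserves g a ->
  Omega a f = Omega a g -> agree_mod a f g.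
Proof. by move=> fa ga fg x; apply/qpiP; rewrite -!OmegaE ?fg. Qed.

Lemma Omega_cancel (f g : M) : preserves f a -> preserves g a ->
  cancel f g -> cancel (Omega a f) (Omega a g).
Proof. by move=> fa ga fK c; rewrite -[c]qpi_repr !OmegaE ?fK. Qed.

Lemma Omega_rmul q : Omega a (rmul q) = rmul (qpi a q).
Proof. by apply: funext => c; rewrite /Omega /rmul qpi_hom qpi_repr. Qed.

Hypotheses (Qcomp : compact [set: Q]) (aopen : open_congruence a).

(** [Omega a] is constant on the neighbourhood [agree_mod a f] of [f]. *)
Lemma Omega_within_continuous (A : set M) :
  A `<=` qEnd Q -> {within A, continuous (Omega a)}.
Proof.
move=> AE; apply/subspace_continuousP => f Af U /nbhs_singleton Uf.
apply: filterS (agree_mod_nbhs Qcomp aopen (AE f Af).1) => g fg _.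
by suff : U (Omega a g) by []; rewrite -(Omega_agree_mod fg).
Qed.

Lemma Omega_End (f : M) : qEnd Q f -> preserves f a -> qEnd Qa (Omega a f).
Proof.
move=> [fc fm] fa; split.
  by apply/continuousP => A _; exact: quot_discrete.
move=> c d; rewrite -[c]qpi_repr -[d]qpi_repr -qpi_hom !OmegaE//.
by rewrite fm qpi_hom.
Qed.

Hypothesis achar : characteristic a.

Lemma Omega_Aut (f : M) : qAut Q f -> qAut Qa (Omega a f).
Proof.
move=> fA; have [fE [g gE [fK gK]]] := fA; have fa := achar fA.
have gA : qAut Q g by split=> //; exists f.
have ga := achar gA.
split; first exact: Omega_End.
by exists (Omega a g); [exact: Omega_End|split; exact: Omega_cancel].
Qed.

End Omega.

(** * Inner automorphisms *)

Section AbstractInn.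
Variable X : preTopologicalQuandleType.
Hypothesis rAut : range (@rmul X) `<=` qAut X.

Lemma qInn_abs_rmul q : qInn_abs X (rmul q).
Proof. by move=> G [_]; apply; exists q. Qed.

Lemma qInn_abs_Aut : qInn_abs X `<=` qAut X.
Proof. by move=> f; apply; split=> //; exact: qAut_subgroup. Qed.

Lemma qInn_abs_subgroup : aut_subgroup (qInn_abs X).
Proof.
split=> [||f g fI gI|f g fI fK gK].
- exact: qInn_abs_Aut.
- by move=> G [[]].
- by move=> G GP; have [[_ _ GM _] _] := GP; exact: GM (fI G GP) (gI G GP).
- by move=> G GP; have [[_ _ _ GV] _] := GP; exact: GV (fI G GP) fK gK.
Qed.

Lemma qInn_abs_qInn : qInn_abs X `<=` qInn X.
Proof. by move=> f fI; split; [exact: qInn_abs_Aut|exact: subset_closure]. Qed.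

End AbstractInn.

Lemma rmul_Aut (X : preTopologicalQuandleType) :
  (forall q : X, continuous (fun x : X => x *q q)) ->
  (forall q : X, continuous (fun x : X => x /q q)) ->
  range (@rmul X) `<=` qAut X.
Proof.
move=> mc dc _ [q _ <-].
have dK : cancel (rmul q) (fun x => x /q q) by move=> x; exact: qmulK.
have dK' : cancel (fun x => x /q q) (rmul q) by move=> x; exact: qdivK.
have rhom : quandle_hom (rmul q : X -> X) by move=> x y; exact: qmul_dist.
split; first by split=> //; exact: mc.
exists (fun x => x /q q); last by split.
split; first exact: dc.
by move=> x y; apply: (can_inj dK); rewrite rhom !dK'.
Qed.

Section Inn.
Variables (Q : preTopologicalQuandleType) (a : congruence Q).
Hypotheses (Qcomp : compact [set: Q]) (aopen : open_congruence a).
Hypotheses (achar : characteristic a) (rAut : range (@rmul Q) `<=` qAut Q).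
Local Notation Qa := (quandle_quot a).

Lemma quot_rmul_Aut : range (@rmul Qa) `<=` qAut Qa.
Proof.
move=> _ [c _ <-]; rewrite -[c]qpi_repr -Omega_rmul.
by apply: Omega_Aut => //; apply: rAut; exists (repr c).
Qed.

(** Both inclusions are instances of minimality: the preimage under [Omega a] of a
    subgroup of automorphisms of the quotient, and the image of a subgroup of
    automorphisms of [Q], are again such subgroups, and [Omega_rmul] matches the
    generators. *)
Lemma Omega_qInn_abs : Omega a @` qInn_abs Q = qInn_abs Qa.
Proof.
have [IA I1 IM IV] := qInn_abs_subgroup rAut.
have [JA J1 JM JV] := qInn_abs_subgroup quot_rmul_Aut.
apply/seteqP; split.
  move=> _ [f fI <-]; suff [] : (qAut Q `&` Omega a @^-1` qInn_abs Qa) f by [].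
  apply: fI; split.
    have [_ A1 AM AV] := qAut_subgroup Q.
    split=> [g []//||g h [gA gJ] [hA hJ]|g h [gA gJ] gK hK].
    - by split=> //=; rewrite Omega1.
    - by split; [exact: AM|rewrite /= OmegaM; [exact: JM|exact: achar]].
    - have hA : qAut Q h by exact: AV gA gK hK.
      by split=> //; apply: JV gJ _ _; apply: Omega_cancel => //; exact: achar.
  move=> _ [q _ <-]; split; first by apply: rAut; exists q.
  by rewrite /= Omega_rmul; exact: qInn_abs_rmul.
move=> h; apply; split.
  split=> [_ [f fI <-]||_ _ [f fI <-] [g gI <-]|_ h' [f fI <-] fK h'K].
  - by apply: Omega_Aut => //; exact: IA.
  - by exists 1%g => //; exact: Omega1.
  - by exists (f * g)%g; [exact: IM|rewrite OmegaM//; apply: achar; exact: IA].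
  - have [_ [g gE [fg gf]]] := IA f fI.
    have gI : qInn_abs Q g by exact: IV fI fg gf.
    exists g => //; apply: funext => c; rewrite -[c in LHS]h'K.
    by apply: Omega_cancel fg _; apply: achar; exact: IA.
move=> _ [c _ <-]; exists (rmul (repr c)); first exact: qInn_abs_rmul.
by rewrite Omega_rmul qpi_repr.
Qed.

(** An element of the closure agrees modulo [a] with an element of the abstract
    group, so both have the same image; on the finite discrete quotient the
    closure is the abstract group itself. *)
Lemma Omega_qInn : Omega a @` qInn Q = qInn Qa.
Proof.
rewrite (finite_qInn (quot_finite_discrete Qcomp aopen)) -Omega_qInn_abs.
apply/seteqP; split; last exact/image_subset/qInn_abs_qInn.
move=> _ [f [[[fc _] _] fcl] <-].
have [g [gI fg]] := fcl _ (agree_mod_nbhs Qcomp aopen fc).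
by exists g => //; exact/esym/Omega_agree_mod.
Qed.

End Inn.

(** * Limits over a fundamental system *)

Section Limits.
Variables (Q : preTopologicalQuandleType) (O : set (congruence Q)).
Hypotheses (Qcomp : compact [set: Q]) (Qhaus : hausdorff_space Q).
Hypotheses (Ofund : fundamental_system O).
Hypotheses (Oopen : forall a, O a -> open_congruence a).
Local Notation M := {compact-open, Q -> Q}.

(** Congruences are compatible with [*q] and [/q], so these are continuous in the
    first variable. *)
Lemma fundamental_rmul_Aut : range (@rmul Q) `<=` qAut Q.
Proof.
by apply: rmul_Aut => q; apply: (fundamental_continuous Qhaus Ofund Oopen)
  => a _ x y xy; [apply: congr_mul|apply: congr_div] => //; exact: congr_refl.
Qed.

(** The filter generated by the [agree_mod a f] converges to [f]. *)
Lemma agree_mod_closure (B : set M) (f : M) : continuous (f : Q -> Q) ->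
  (forall a, O a -> exists2 g, B g & agree_mod a f g) -> closure B f.
Proof.
move=> fc fB U Uf; pose F := filter_from O (fun a => agree_mod a f).
have FF : Filter F.
  apply: filter_from_filter; first exact: (fundamental_ex Ofund).
  move=> a b Oa Ob; have [c [Oc ca cb]] := fundamental_lb Ofund Oa Ob.
  by exists c => // g fg; split=> x; [exact: ca|exact: cb].
have [a Oa aU] : F U.
  by apply: (agree_mod_cvg Qhaus Ofund FF fc) Uf => a Oa; exists a.
by have [g Bg fg] := fB a Oa; exists g; split=> //; exact: aU.
Qed.

(** The glued automorphism [f] agrees modulo [a] with [phi a], which agrees modulo
    [a] with an element of the abstract group, so [f] lies in its closure. *)
Lemma glue_Inn : glues O (qAut Q) -> glues O (qInn Q).
Proof.
move=> gAut phi phiI coh.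
have [|f fA fP] := gAut _ _ coh; first by move=> a /phiI[].
exists f => //; split=> //.
apply: agree_mod_closure => [|a Oa]; first exact: fA.1.1.
have [[[phic _] _] phicl] := phiI a Oa.
have [g [gI ag]] := phicl _ (agree_mod_nbhs Qcomp (Oopen Oa) phic).
by exists g => // x; exact: congr_trans (fP a Oa x) (ag x).
Qed.

(** The hypothesis [glues O A] is exactly the surjectivity of [f |-> (Omega a f)_a]
    onto the limit; injectivity and the two continuity statements only use that
    maps in [A] are continuous and preserve the congruences of [O]. *)
Lemma lim_iso (A : set M) : A `<=` qEnd Q ->
  (forall a f, O a -> A f -> preserves f a) -> glues O A ->
  top_monoid_iso A (quot_lim O (fun a => Omega a @` A)).
Proof.
move=> AE Apres Aglue.
pose F (f : M) : prod_topology (fun a : O =>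
    {compact-open, quandle_quot (val a) -> quandle_quot (val a)}) :=
  fun a => Omega (val a) f.
have OP (i : O) : O (val i) := set_valP i.
have FA f : A f -> quot_lim O (fun a => Omega a @` A) (F f).
  move=> Af; split=> [i|i j ij]; first by exists f.
  by apply: quot_trans_Omega => //; apply: (Apres _ f).
have Finj f g : A f -> A g -> F f = F g -> f = g.
  move=> Af Ag fg; apply: funext => x.
  apply: (fundamental_separates Qhaus Ofund) => a Oa.
  apply: (@agree_mod_Omega Q a f g); [exact: Apres|exact: Apres|].
  exact: (congr1 (fun h => h (SigSub (mem_set Oa))) fg).
have Fsurj h : quot_lim O (fun a => Omega a @` A) h -> exists2 f, A f & F f = h.
  move=> [hA ht].
  have /choice[phi phiP] : forall a, exists f, forall Oa : O a,
      A f /\ Omega a f = h (SigSub (mem_set Oa)).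
    move=> a; have [Oa|nOa] := pselect (O a); last by exists id.
    have [f Af fh] := hA (SigSub (mem_set Oa)).
    by exists f => Oa'; rewrite (Prop_irrelevance Oa' Oa).
  have [a /phiP[]//|a c Oa Oc ca|f Af fP] := Aglue phi.
    have [Aa ha] := phiP a Oa; have [Ac hc] := phiP c Oc.
    apply: agree_mod_Omega; [exact: Apres|exact: Apres|].
    rewrite -(quot_trans_Omega ca (Apres _ _ Oc Ac) (Apres _ _ Oa Ac)).
    rewrite ha hc; apply/esym.
    exact: (ht (SigSub (mem_set Oa)) (SigSub (mem_set Oc)) ca).
  exists f => //; apply: functional_extensionality_dep => -[a aO].
  have Oa : O a := set_mem aO; have [_] := phiP a Oa.
  rewrite (bool_irrelevance (mem_set Oa) aO) => <-.
  by apply: Omega_agree_mod; exact: fP.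
have /choice[G GP] : forall h, exists f,
    quot_lim O (fun a => Omega a @` A) h -> A f /\ F f = h.
  move=> h.
  have [/Fsurj[f Af fh]|nh] := pselect (quot_lim O (fun a => Omega a @` A) h).
    by exists f.
  by exists id.
exists F; split; first split.
- split=> [f /FA//|f g|h /Fsurj[f]]; last by exists f.
  by rewrite !inE => Af Ag; exact: Finj.
- apply/subspace_continuousP => f Af.
  apply: prod_topology_cvg => a U Ua.
  have /subspace_continuousP :=
    Omega_within_continuous Qcomp (Oopen (set_valP a)) AE.
  exact.
- (* The coordinate [h' a] determines [G h'] modulo [a], and its value at [h] is
     taken on a neighbourhood of [h]. *)
  exists G.
    move=> f; rewrite inE => Af; have [AG FG] := GP _ (FA f Af).
    exact: Finj.
  apply/subspace_continuousP => h hL; have [AG FG] := GP h hL.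
  apply: (agree_mod_cvg Qhaus Ofund); first exact: (AE _ AG).1.
  move=> a Oa; pose i : O := SigSub (mem_set Oa).
  have hi : nbhs h [set h' : prod_topology (fun a : O =>
      {compact-open, quandle_quot (val a) -> quandle_quot (val a)}) | h' i = h i].
    apply: (@prod_coord_nbhs _ _ h i [set h i]).
    apply: open_nbhs_nbhs; split=> //.
    apply: finite_discrete_compact_open.
    exact: quot_finite_discrete Qcomp (Oopen Oa).
  apply: filterS hi => h' h'i h'L; have [AG' FG'] := GP h' h'L.
  apply: agree_mod_Omega; [exact: Apres|exact: Apres|].
  by rewrite -[LHS]/(F (G h) i) -[RHS]/(F (G h') i) FG FG' h'i.
- by apply: functional_extensionality_dep => a; exact: Omega1.
- move=> f g; rewrite !inE => Af Ag.
  apply: functional_extensionality_dep => a; apply: OmegaM.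
  by apply: Apres => //; exact: set_valP.
Qed.

End Limits.

Theorem theorem5p10 (Q : preTopologicalQuandleType) (profQ : profinite_quandle Q) :
  (forall O : set (congruence Q),
     fundamental_system O ->
     (forall a, O a -> open_congruence a /\ fully_invariant a) ->
     (forall a, O a -> continuous_map (qEnd Q) (qEnd (quandle_quot a)) (Omega a)) /\
     top_monoid_iso (qEnd Q) (quot_lim O (fun a => Omega a @` qEnd Q)))
  /\
  (forall O : set (congruence Q),
     fundamental_system O ->
     (forall a, O a -> open_congruence a /\ characteristic a) ->
     [/\ (forall a, O a ->
            continuous_map (qAut Q) (qAut (quandle_quot a)) (Omega a)),
         (forall a, O a ->
            continuous_map (qInn Q) (qInn (quandle_quot a)) (Omega a)),
         top_monoid_iso (qAut Q) (quot_lim O (fun a => Omega a @` qAut Q)),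
         top_monoid_iso (qInn Q) (quot_lim O (fun a => Omega a @` qInn Q)) &
         top_monoid_iso (qInn Q)
           (quot_lim (@open_characteristic Q) (fun a => qInn (quandle_quot a)))]).
Proof.
have [Qcomp Qhaus] := profinite_compact_hausdorff profQ.
have AutEnd : qAut Q `<=` qEnd Q by move=> f [].
have InnEnd : qInn Q `<=` qEnd Q by move=> f [[]].
split=> O Ofund OP.
  have Oopen a : O a -> open_congruence a by case/OP.
  have Opres a f : O a -> qEnd Q f -> preserves f a by case/OP => _; apply.
  split=> [a Oa|]; first split.
  - by move=> f fE; apply: Omega_End => //; [exact: Oopen|exact: Opres].
  - by apply: Omega_within_continuous => //; exact: Oopen.
  apply: lim_iso => // phi phiE coh.
  apply: (glue_End Qcomp Qhaus Ofund Oopen) coh => a Oa.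
  by split; [exact: phiE|apply: Opres => //; exact: phiE].
have rAut : range (@rmul Q) `<=` qAut Q.
  by apply: (fundamental_rmul_Aut Qhaus Ofund) => a /OP[].
have isos (P : set (congruence Q)) : fundamental_system P ->
    (forall a, P a -> open_congruence a /\ characteristic a) ->
    top_monoid_iso (qAut Q) (quot_lim P (fun a => Omega a @` qAut Q)) /\
    top_monoid_iso (qInn Q) (quot_lim P (fun a => Omega a @` qInn Q)).
  move=> Pfund PP.
  have Popen a : P a -> open_congruence a by case/PP.
  have Ppres a f : P a -> qAut Q f -> preserves f a by case/PP => _; apply.
  have gAut : glues P (qAut Q).
    exact: (glue_Aut Qcomp Qhaus Pfund Popen).
  split; apply: lim_iso => //.
    by move=> a f Pa [fA _]; exact: Ppres.
  exact: glue_Inn.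
have [isoA isoI] := isos O Ofund OP.
split=> // [a Oa|a Oa|].
- have [aopen achar] := OP a Oa; split; last exact: Omega_within_continuous.
  by move=> f; exact: Omega_Aut.
- have [aopen achar] := OP a Oa; split; last exact: Omega_within_continuous.
  by move=> f fI; rewrite -Omega_qInn //; exists f.
have Cfund : fundamental_system (@open_characteristic Q).
  split=> [a [aopen _] [x x'] xx'|E /(Ofund.2 E)[a Oa aE]].
    rewrite -(xx' : x = x').
    by apply: open_nbhs_nbhs; split=> //; exact: congr_refl.
  by exists a => //; exact: OP.
have [//|_] := isos _ Cfund.
have InnE (i : @open_characteristic Q) :
    Omega (val i) @` qInn Q = qInn (quandle_quot (val i)).
  by have [iopen ichar] := set_valP i; exact: Omega_qInn.
congr (top_monoid_iso _ _); apply/seteqP.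
split=> h [hA ht]; split=> // i; by have := hA i; rewrite InnE.
Qed.
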